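(* Let $k\ge 2$ be an integer, let $1<p\le q<\infty$, $0<\alpha<1$ and $\epsilon\in(0,1)$. If $w\in \mathcal{Z}_{p,q}^{\epsilon,\alpha}$, then the spherical fractional maximal operator $\mathcal{S}_\alpha$ is bounded from $L^p(w)$ to $L^q(w)$ on the infinite rooted $k$-ary tree $\mathcal{T}^k$; that is, there is a constant $C'>0$ such that for every function $f$ on $\mathcal{T}^k$, $$\|\mathcal{S}_\alpha f\|_{L^q(w)}\le C'\,\|f\|_{L^p(w)}.$$
   Context: $\mathcal{T}^k$ is the infinite rooted $k$-ary tree: the infinite rooted tree in which every vertex has exactly $k$ children (successors). It is identified with its set of vertices. $d(x,y)$ is the number of edges of the unique minimal path joining $x$ and $y$, and $|A|$ is the cardinality (counting measure) of $A\subset\mathcal{T}^k$. $\mathbb{N}=\{1,2,\dots\}$ and $\mathbb{N}_0=\mathbb{N}\cup\{0\}$. For $x\in\mathcal{T}^k$ and $r\in\mathbb{N}_0$, $S(x,r)=\{y\in\mathcal{T}^k: d(x,y)=r\}$. The spherical fractional maximal operator is $$\mathcal{S}_\alpha f(x)=\sup_{r\in\mathbb{N}_0}\frac{1}{|S(x,r)|^{1-\alpha}}\sum_{y\in S(x,r)}|f(y)|.$$ A weight is a non-negative function $w$ on $\mathcal{T}^k$; $w(A)=\sum_{x\in A}w(x)$ for $A\subset\mathcal{T}^k$, and $\|f\|_{L^p(w)}=\big(\sum_{x\in\mathcal{T}^k}|f(x)|^pw(x)\big)^{1/p}$. For $1<p,q<\infty$, $0<\alpha<1$ and $\epsilon\in(0,1)$,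 a weight $w$ belongs to $\mathcal{Z}_{p,q}^{\epsilon,\alpha}$ if there is a constant $C>0$ such that for all $r\in\mathbb{N}$ and all sets $E,F\subset\mathcal{T}^k$, $$\sum_{x\in E}w(F\cap S(x,r))\le C\,k^{\epsilon r(1-\alpha)}\,w(E)^{1/p}\,w(F)^{1-1/q}.$$ *)

(* Defs.v *)
From HB Require Import structures.
From mathcomp Require Import all_boot all_order all_algebra.
From mathcomp Require Import all_classical all_reals all_analysis.

Set Implicit Arguments.
Unset Strict Implicit.
Unset Printing Implicit Defensive.

Import Order.TTheory GRing.Theory Num.Theory.

Local Open Scope classical_set_scope.
Local Open Scope ring_scope.

(* A vertex is the word of child labels read from the vertex up to the root:
   the root is [::] and the k children of x are the words i :: x, i : 'I_k. *)
Definition tree (k : nat) : Type := seq 'I_k.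

HB.instance Definition _ (k : nat) := Choice.copy (tree k) (seq 'I_k).

Definition child (k : nat) : rel (tree k) :=
  fun x y => [exists i : 'I_k, y == i :: x].

Definition edge (k : nat) : rel (tree k) := fun x y => child x y || child y x.

Definition walk_length (k : nat) (x y : tree k) : pred nat :=
  fun n => `[< exists s : seq (tree k),
                 [/\ path (@edge k) x s, last x s = y & size s = n] >].

Lemma tree_connected (k : nat) (x y : tree k) : exists n, walk_length x y n.
Proof.
have up : exists2 s, path (@edge k) x s & last x s = ([::] : tree k).
  elim: x => [|i x [s px lx]]; first by exists [::].
  exists ((x : tree k) :: s) => //=; rewrite px andbT /edge /child.
  by apply/orP; right; apply/existsP; exists i.
have down : exists2 s, path (@edge k) ([::] : tree k) s & last [::] s = y.
  elim: y => [|i y [s py ly]]; first by exists [::].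
  exists (rcons s (i :: y : tree k)); last by rewrite last_rcons.
  rewrite rcons_path py ly /edge /child.
  by apply/orP; left; apply/existsP; exists i.
case: up down => s ps ls [t pt lt]; exists (size (s ++ t)); apply/asboolP.
by exists (s ++ t); split; rewrite // ?cat_path ?ps ?last_cat ls.
Qed.

Definition tree_dist (k : nat) (x y : tree k) : nat :=
  ex_minn (tree_connected x y).

Definition sphere (k : nat) (x : tree k) (r : nat) : set (tree k) :=
  [set y | tree_dist x y = r].

Local Open Scope ereal_scope.

(* The supremum may be infinite, so the maximal function is \bar R-valued. *)
Definition spherical_fractional_max (R : realType) (k : nat) (alpha : R)
    (f : tree k -> R) (x : tree k) : \bar R :=
  ereal_sup (range (fun r : nat =>
    (counting (sphere x r) `^ (1 - alpha))^-1 *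
    \esum_(y in sphere x r) (`|f y|%R)%:E)).

Definition wmass (R : realType) (k : nat) (w : tree k -> R)
    (A : set (tree k)) : \bar R :=
  \esum_(x in A) (w x)%:E.

Definition Lp_norm (R : realType) (k : nat) (w : tree k -> R) (p : R)
    (f : tree k -> \bar R) : \bar R :=
  (\esum_(x in [set: tree k]) ((`|f x| `^ p) * (w x)%:E)) `^ p^-1.

(* In the right-hand side 0 * +oo = 0.  This convention is harmless: finite E
   and F already force a weight vanishing at one vertex to vanish everywhere. *)
Definition Z_class (R : realType) (k : nat) (p q eps alpha : R)
    (w : tree k -> R) : Prop :=
  (forall x, (0 <= w x)%R) /\
  exists2 C : R, (0 < C)%R &
    forall (r : nat) (E F : set (tree k)), (0 < r)%N ->
      \esum_(x in E) wmass w (F `&` sphere x r) <=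
      C%:E * (k%:R `^ (eps * r%:R * (1 - alpha)))%:E *
      (wmass w E `^ p^-1) * (wmass w F `^ (1 - q^-1)).

(* Main.v *)
Require Import Defs.
From mathcomp Require Import all_boot all_order all_algebra.
From mathcomp Require Import all_classical all_reals all_analysis.
From mathcomp Require Import ring lra zify.
Import Order.TTheory GRing.Theory Num.Theory.
Local Open Scope classical_set_scope.
Local Open Scope ring_scope.
Set Implicit Arguments.
Unset Strict Implicit.
Unset Printing Implicit Defensive.

(** The spheres satisfy k^r <= |S(x,r)| <= k^(2r), so the supremum defining
    S_alpha f is at most the supremum over r of the averages
      A_r f(y) = k^(-r(1-alpha)) * (sum of |f| over S(y,r)),
    and its q-th power is at most the sum over r of (A_r f)^q
    ([spherical_max_powR_le]). It therefore suffices to bound the L^p(w) to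
    L^q(w) norm of A_r by a geometric sequence in r ([sphere_avg_decay]).

    Let T_r f(y) be the sum of f over S(y,r), for r >= 1. The distance being
    symmetric, the hypothesis on w says exactly that T_r is of restricted weak
    type: for indicators,
      <T_r 1_E, 1_F>_w <= M w(E)^(1/p) w(F)^(1-1/q),  M = C k^(eps r(1-alpha)).
    Compared with the normalization k^(r(1-alpha)) of A_r this leaves the
    spare factor k^(-(1-eps)(1-alpha) r). A part of it pays for passing from
    restricted weak type to strong type ([restricted_weak_to_strong]): cut f
    into layers B^j <= |f| < B^(j+1) with B = k^(2r/D), so that a sphere has at
    most B^D points. On one sphere only the D+1 highest layers matter, since
    all lower ones together weigh no more than a single point of the highest.
    Hence some layer j carries the fraction 1/(D+2) of the sum, and it meets
    the sphere in about B^i points with 0 <= i <= D ([layer_pigeonhole]). For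
    each pair (i,j) the restricted weak type bound controls the set of such
    centres ([layer_weak_type]); summing over i costs a factor D+1, and the
    sum over j closes because t |-> t^(q/p) is superadditive for p <= q. The
    total loss is a constant times B^2 = k^(4r/D), which for D large uses up
    at most half of the spare exponent.

    For r = 0 the operator A_0 is the identity, and L^p(w) embeds in L^q(w) as
    soon as w <= K w^(q/p). This follows from the hypothesis for pairs of
    neighbouring singletons ([weight_power_bound]).

    These estimates are carried out on finite families of vertices: solving a
    restricted weak type inequality for w(F) divides by a power of w(F), which
    says nothing when w(F) is infinite. *)

(** * Real powers and multiplicative levels *)

Definition level (R : realType) (B v : R) : int := Num.floor (ln v / ln B).

Lemma powR_level (R : realType) (B v : R) : 1 < B -> 0 < v ->
  B `^ (level B v)%:~R <= v < B `^ ((level B v)%:~R + 1).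
Proof.
move=> B1 v0; have lB : 0 < ln B by rewrite ln_gt0.
have B0 : 0 < B by rewrite (lt_trans ltr01).
have vE : v = B `^ (ln v / ln B).
  by rewrite /powR gt_eqF// divfK ?gt_eqF// lnK.
rewrite [X in _ <= X < _]vE; apply/andP; split.
  by rewrite ler_powR ?floor_le ?(ltW B1).
rewrite /powR gt_eqF// ltr_expR ltr_pM2r//.
by rewrite -[1]/(1%:~R) -intrD floorD1_gt.
Qed.

(** This is where p <= q enters, with t = q / p: each a_i ^ t is a_i times
    a_i ^ (t - 1), and the second factor is at most its value at the full sum. *)
Lemma sum_powR_le (R : realType) (I : Type) (s : seq I) (a : I -> R) (t : R) :
  1 <= t -> (forall i, 0 <= a i) ->
  \sum_(i <- s) a i `^ t <= (\sum_(i <- s) a i) `^ t.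
Proof.
move=> t1 a0; have t0 : 0 < t by rewrite (lt_le_trans ltr01).
have split_powR u : 0 <= u -> u `^ t = u * u `^ (t - 1).
  by move=> ?; rewrite mulr_powRB1.
elim: s => [|i s IH]; first by rewrite !big_nil powR0 ?gt_eqF.
rewrite !big_cons; set A := \sum_(j <- s) a j in IH *.
have A0 : 0 <= A by exact: sumr_ge0.
apply: (le_trans (lerD (lexx _) IH)).
rewrite [leRHS]split_powR ?addr_ge0// mulrDl !split_powR//.
apply: lerD; apply: ler_wpM2l => //; apply: ge0_ler_powR;
  by rewrite ?nnegrE ?subr_ge0 ?addr_ge0 ?lerDl ?lerDr.
Qed.

(** Dividing by a ^ (1 - 1/q) turns a restricted weak type inequality into a
    level set estimate; this needs a to be finite, hence the restriction to
    finite sets of centres below. *)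
Lemma weak_type_solve (R : realType) (a b c q : R) :
  0 <= a -> 0 < b -> 0 <= c -> 0 < q ->
  b * a <= c * a `^ (1 - q^-1) -> a <= (c / b) `^ q.
Proof.
move=> a0 b0 c0 q0; move: a0; rewrite le_eqVlt => /orP[/eqP <- _|a0].
  exact: powR_ge0.
rewrite powRB ?(gt_eqF a0) ?implybT// powRr1 ?(ltW a0)// => h.
have aq0 : 0 < a `^ q^-1 by rewrite powR_gt0.
have le_root : a `^ q^-1 <= c / b.
  rewrite ler_pdivlMr// mulrC -(ler_pM2r a0) mulrAC -ler_pdivlMr//.
  by rewrite -mulrA.
have -> : a = (a `^ q^-1) `^ q by rewrite -powRrM mulVf ?gt_eqF// powRr1 ?ltW.
by apply: ge0_ler_powR; rewrite ?nnegrE ?divr_ge0// ltW.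
Qed.

Lemma ltr_powRr (R : realType) (B x y : R) : 1 < B -> (B `^ x < B `^ y) = (x < y).
Proof.
move=> B1; rewrite /powR gt_eqF ?(lt_trans ltr01)//.
by rewrite ltr_expR ltr_pM2r// ln_gt0.
Qed.

Lemma powR_add (R : realType) (B x y : R) : 0 < B -> B `^ (x + y) = B `^ x * B `^ y.
Proof. by move=> B0; rewrite powRD// (gt_eqF B0) implybT. Qed.

(** * Layers of a function on a finite sequence *)

Definition layer (R : realType) (T : Type) (B : R) (g : T -> R) (j : int) : pred T :=
  fun x => (0 < g x) && (level B (g x) == j).

Lemma seq_argmax (R : realType) (T : eqType) (S : seq T) (g : T -> R) :
  S != [::] -> exists2 x0, x0 \in S & forall x, x \in S -> g x <= g x0.
Proof.
elim: S => // a [|b S] IH _.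
  by exists a; rewrite ?mem_head// => x; rewrite inE => /eqP ->.
have [//|x0 x0S x0max] := IH; have [le0|lt0] := leP (g a) (g x0).
  exists x0; first by rewrite inE x0S orbT.
  by move=> x; rewrite inE => /orP[/eqP ->//|]; exact: x0max.
exists a; first exact: mem_head.
move=> x; rewrite inE => /orP[/eqP ->//|/x0max xx0].
exact: (le_trans xx0 (ltW lt0)).
Qed.

Lemma int_window (J m : int) (D : nat) : m <= J -> J - m <= D%:Z ->
  (`|J - m| < D.+1)%N /\ J - `|J - m|%N%:Z = m.
Proof. by move=> mJ Jm; split; lia. Qed.

(** Bounding g x by this window of D + 1 layers, counted down from the layer of
    the upper bound G, makes the pigeonhole argument a plain summation over x:
    the points below G / B ^ D are absorbed by the first term. *)
Lemma level_window (R : realType) (T : Type) (g : T -> R) (B G : R) (D : nat) x :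
  1 < B -> 0 <= g x -> g x <= G ->
  g x <= G * B `^ (- D%:R) + \sum_(l < D.+1)
    (layer B g (level B G - l%:Z) x)%:R * B `^ ((level B G - l%:Z)%:~R + 1).
Proof.
move=> B1 gx0 gG; have B0 : 0 < B by rewrite (lt_trans ltr01).
have [small|large] := leP (g x) (G * B `^ (- D%:R)).
  by rewrite (le_trans small)// lerDl sumr_ge0// => l _; rewrite mulr_ge0 ?powR_ge0.
have G0 : 0 <= G by exact: le_trans gG.
have gx : 0 < g x by rewrite (le_lt_trans _ large)// mulr_ge0 ?powR_ge0.
have Gpos : 0 < G by exact: lt_le_trans gG.
have /andP[lG Gu] := powR_level B1 Gpos.
have /andP[lx xu] := powR_level B1 gx.
set J := level B G in lG Gu *; set m := level B (g x) in lx xu.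
have mJ : m <= J.
  have := le_lt_trans lx (le_lt_trans gG Gu).
  by rewrite ltr_powRr// -[1]/(1%:~R) -intrD ltr_int ltzD1.
have Jm : J - m <= D%:Z.
  have := le_lt_trans (ler_wpM2r (powR_ge0 B (- D%:R)) lG) (lt_trans large xu).
  rewrite -powR_add// ltr_powRr//.
  have -> : J%:~R - D%:R = (J - D%:Z)%:~R :> R by rewrite intrB.
  by rewrite -[1]/(1%:~R) -intrD ltr_int ltzD1 !lerBlDr addrC.
have [lD Jl] := int_window mJ Jm.
rewrite (bigD1 (Ordinal lD))//= /layer gx/=.
rewrite Jl eqxx mul1r (le_trans (ltW xu))//.
rewrite addrCA lerDl addr_ge0 ?mulr_ge0 ?powR_ge0//.
by rewrite sumr_ge0// => l _; rewrite mulr_ge0 ?powR_ge0.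
Qed.

(** Among the D + 1 layers counted down from that of the maximum, the one with
    the largest B ^ j times its number of points is chosen. The points below
    the window number at most B ^ D and weigh at most one copy of the maximum,
    so they count as one more layer; this explains D + 2. One power of B comes
    from rounding the values of g down, the other from rounding the number of
    points down to B ^ i. *)
Lemma layer_pigeonhole (R : realType) (T : eqType) (S : seq T) (g : T -> R)
    (B : R) (D : nat) :
  1 < B -> (size S)%:R <= B `^ D%:R -> (forall x, 0 <= g x) ->
  0 < \sum_(x <- S) g x ->
  exists (i : 'I_D.+1) (j : int),
    B `^ i%:R <= (count (layer B g j) S)%:R /\
    \sum_(x <- S) g x <= D.+2%:R * B `^ (i%:R + j%:~R + 2).
Proof.
move=> B1 sizeS g0 sum0; have B0 : 0 < B by rewrite (lt_trans ltr01).
have S0 : S != [::].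
  by apply: contraTneq sum0 => ->; rewrite big_nil ltxx.
have [x0 x0S x0max] := seq_argmax g S0.
set G := g x0 in x0max; set J := level B G.
have G0 : 0 < G.
  rewrite lt_neqAle g0 andbT; apply: contraTneq sum0 => G0.
  rewrite -leNgt big_seq sumr_le0// => x xS.
  by rewrite (le_trans (x0max _ xS))// -G0.
pose c (l : 'I_D.+1) := count (layer B g (J - l%:Z)) S.
pose m (l : 'I_D.+1) := B `^ (J - l%:Z)%:~R * (c l)%:R.
have [l _ lmax'] := @arg_maxP _ _ _ (ord0 : 'I_D.+1) xpredT m isT.
have lmax l' : m l' <= m l by exact: lmax'.
have sum_le : \sum_(x <- S) g x <= D.+2%:R * (B * m l).
  have -> : D.+2%:R * (B * m l) = B * m l + \sum_(l' < D.+1) B * m l.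
    by rewrite sumr_const card_ord -[D.+2]addn1 natrD mulrDl mul1r addrC mulr_natl.
  have win x : x \in S -> g x <= _ := fun xS =>
    @level_window R T g B G D x B1 (g0 x) (x0max x xS).
  rewrite big_seq; apply: (le_trans (ler_sum _ win)); rewrite -big_seq.
  rewrite big_split/= big_const_seq count_predT iter_addr_0 exchange_big/=.
  apply: lerD.
    (* the part below the window weighs at most the maximum, hence at most
       the contribution of the top layer, which contains x0 *)
    have : G <= B * m ord0.
      have c0 : 1 <= (c ord0)%:R :> R.
        rewrite ler1n -has_count; apply/hasP; exists x0 => //.
        by rewrite /layer G0/= subr0.
      have /andP[_ /ltW Gu] := powR_level B1 G0.
      rewrite (le_trans Gu)// /m subr0 powR_add//.
      by rewrite powRr1 ?(ltW B0)// mulrCA ler_wpM2l ?powR_ge0// ler_peMr// ltW.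
    move=> GB; apply: le_trans (le_trans GB _); last by rewrite ler_pM2l// lmax.
    rewrite -[leLHS]mulr_natr -mulrA ger_pMr//.
    by rewrite powRN mulrC ler_pdivrMr ?powR_gt0// mul1r.
  apply: ler_sum => l' _; rewrite -mulr_suml.
  have -> : \sum_(x <- S) (layer B g (J - l'%:Z) x)%:R = (c l')%:R :> R.
    by rewrite -natr_sum /c -sumn_count sumnE big_map.
  rewrite powR_add// powRr1 ?(ltW B0)//.
  apply: le_trans (_ : B * m l' <= _); last by rewrite ler_pM2l// lmax.
  by rewrite /m -/J le_eqVlt; apply/orP; left; apply/eqP; ring.
have c0 : (0 < c l)%N.
  rewrite lt0n; apply: contraTneq (lt_le_trans sum0 sum_le) => cl0.
  by rewrite /m cl0 !mulr0 ltxx.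
have cR : 1 <= (c l)%:R :> R by rewrite ler1n.
have /andP[ic ci] := powR_level B1 (lt_le_trans ltr01 cR).
set i := level B (c l)%:R in ic ci.
have i0 : 0 <= i.
  rewrite -ltzD1 -(ltr_int R) intrD -(ltr_powRr _ _ B1) powRr0.
  exact: le_lt_trans ci.
have iD : i <= D%:Z.
  rewrite -(ler_int R) leNgt -(ltr_powRr _ _ B1) -leNgt (le_trans ic)//.
  by rewrite (le_trans _ sizeS)// ler_nat count_size.
have iD' : (`|i|%N < D.+1)%N by rewrite ltnS -lez_nat gez0_abs.
have iE : `|i|%N%:R = i%:~R :> R by rewrite -[LHS]/(`|i|%N%:Z%:~R) gez0_abs.
exists (Ordinal iD'), (J - l%:Z); rewrite /= iE; split => //.
rewrite (le_trans sum_le)// ler_wpM2l// /m.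
have -> : i%:~R + (J - l%:Z)%:~R + 2 = 1 + ((J - l%:Z)%:~R + (i%:~R + 1)) :> R by ring.
rewrite powR_add// powRr1 ?(ltW B0)// ler_wpM2l ?(ltW B0)//.
by rewrite powR_add// ler_wpM2l ?powR_ge0// ltW.
Qed.

(** * From restricted weak type to strong type *)

(** Double counting of the pairs (x, y) with x in the layer and y one of the
    centres whose sphere meets the layer B ^ i times: each such y is counted at
    least B ^ i times, and by symmetry the same pairs are those of the
    restricted weak type inequality. *)
Lemma layer_weak_type (R : realType) (T : eqType) (w : T -> R) (Sph : T -> seq T)
    (p q M B : R) (g : T -> R) (X Y : seq T) (i : nat) (j : int) :
  0 < q -> 0 <= M -> 0 < B -> (forall x, 0 <= w x) ->
  (forall y, uniq (Sph y)) -> (forall x y, (x \in Sph y) = (y \in Sph x)) ->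
  (forall E F : seq T, uniq E -> uniq F ->
    \sum_(x <- E) \sum_(y <- F | y \in Sph x) w y <=
    M * (\sum_(x <- E) w x) `^ p^-1 * (\sum_(y <- F) w y) `^ (1 - q^-1)) ->
  uniq X -> uniq Y -> (forall y, y \in Y -> {subset Sph y <= X}) ->
  \sum_(y <- Y | B `^ i%:R <= (count (layer B g j) (Sph y))%:R) w y <=
  (M * (\sum_(x <- X | layer B g j x) w x) `^ p^-1 / B `^ i%:R) `^ q.
Proof.
move=> q0 M0 B0 w0 uS symS weak uX uY SX.
rewrite -[leLHS]big_filter -[\sum_(x <- X | _) _]big_filter.
set F := [seq y <- Y | _]; set E := [seq x <- X | _].
have uE : uniq E by exact: filter_uniq.
have uF : uniq F by exact: filter_uniq.
apply: weak_type_solve; rewrite ?sumr_ge0 ?powR_gt0 ?mulr_ge0 ?powR_ge0//.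
apply: le_trans (weak _ _ uE uF).
under [leRHS]eq_bigr do rewrite big_mkcond.
rewrite exchange_big mulr_sumr [leLHS]big_seq [leRHS]big_seq; apply: ler_sum => y.
rewrite mem_filter => /andP[yF yY].
rewrite -big_mkcond big_const_seq iter_addr_0 -[leRHS]mulr_natl ler_wpM2r//.
rewrite (le_trans yF)// ler_nat -!size_filter.
apply: uniq_leq_size; first exact: filter_uniq.
move=> x; rewrite !mem_filter => /andP[xj xy].
rewrite -symS xy (SX y yY x xy) andbT; exact: xj.
Qed.

(** Each x with g x > 0 lies in a single layer, on which B ^ j <= g x. *)
Lemma layer_sum_le (R : realType) (T : eqType) (w : T -> R) (p B : R)
    (g : T -> R) (X : seq T) (J : seq int) :
  0 < p -> 1 < B -> (forall x, 0 <= w x) -> uniq J ->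
  \sum_(j <- J) (B `^ j%:~R) `^ p * \sum_(x <- X | layer B g j x) w x <=
  \sum_(x <- X) w x * g x `^ p.
Proof.
move=> p0 B1 w0 uJ.
under eq_bigr do rewrite mulr_sumr big_mkcond.
rewrite exchange_big; apply: ler_sum => x _ /=.
rewrite /layer; have [gx0|gx] := ltP 0 (g x); last first.
  by rewrite big1// mulr_ge0 ?powR_ge0.
have /andP[lg _] := powR_level B1 gx0; rewrite /= -big_mkcond.
have [lJ|lJ] := boolP (level B (g x) \in J); last first.
  rewrite big_seq_cond big1 ?mulr_ge0 ?powR_ge0// => j /andP[jJ /eqP lj].
  by rewrite lj jJ in lJ.
rewrite (eq_bigl (fun j => j == level B (g x))); last by move=> j; rewrite eq_sym.
rewrite -big_filter filter_pred1_uniq// big_seq1 mulrC ler_wpM2l//.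
by apply: ge0_ler_powR; rewrite ?nnegrE ?powR_ge0// ltW.
Qed.

Lemma powR_pth_root (R : realType) (b W p q : R) : 0 <= b -> 0 <= W -> 0 < p ->
  (b `^ p * W) `^ (q / p) = (b * W `^ p^-1) `^ q.
Proof.
move=> b0 W0 p0; have -> : q / p = p^-1 * q by rewrite mulrC.
rewrite powRrM powRM ?powR_ge0//; congr ((_ * _) `^ q).
by rewrite -powRrM mulfV ?gt_eqF// powRr1.
Qed.

Lemma le_sum2 (R : realType) (I : finType) (T : eqType) (a : I -> T -> R) (s : seq T) i j :
  uniq s -> j \in s -> (forall i j, 0 <= a i j) ->
  a i j <= \sum_(j' <- s) \sum_i' a i' j'.
Proof.
move=> us js a0; rewrite (bigD1_seq j)//= (bigD1 i)//= -addrA lerDl.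
by rewrite addr_ge0// sumr_ge0// => *; exact: sumr_ge0.
Qed.

(** Pointwise, the q-th power of the sum over a sphere is at most the sum over
    all (i, j) of its pigeonhole bound on the set where the pair (i, j) is
    possible. The powers of B ^ i in that bound and in the weak type estimate
    cancel, so every i contributes the same amount. *)
Lemma restricted_weak_to_strong (R : realType) (T : eqType) (w : T -> R)
    (Sph : T -> seq T) (p q M B : R) (D : nat) :
  0 < p -> p <= q -> 0 <= M -> 1 < B -> (forall x, 0 <= w x) ->
  (forall y, uniq (Sph y)) -> (forall x y, (x \in Sph y) = (y \in Sph x)) ->
  (forall y, (size (Sph y))%:R <= B `^ D%:R) ->
  (forall E F : seq T, uniq E -> uniq F ->
    \sum_(x <- E) \sum_(y <- F | y \in Sph x) w y <=
    M * (\sum_(x <- E) w x) `^ p^-1 * (\sum_(y <- F) w y) `^ (1 - q^-1)) ->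
  forall (g : T -> R) (X Y : seq T), (forall x, 0 <= g x) ->
  uniq X -> uniq Y -> (forall y, y \in Y -> {subset Sph y <= X}) ->
  \sum_(y <- Y) w y * (\sum_(x <- Sph y) g x) `^ q <=
  D.+1%:R * (D.+2%:R * M * B `^ 2) `^ q *
    (\sum_(x <- X) w x * g x `^ p) `^ (q / p).
Proof.
move=> p0 pq M0 B1 w0 uS symS sizeS weak g X Y g0 uX uY SX.
have B0 : 0 < B by rewrite (lt_trans ltr01).
have q0 : 0 < q by exact: lt_le_trans pq.
pose J := undup [seq level B (g x) | x <- X].
pose many (i : 'I_D.+1) j y : bool := B `^ i%:R <= (count (layer B g j) (Sph y))%:R.
pose K (i : 'I_D.+1) (j : int) := (D.+2%:R * B `^ (i%:R + j%:~R + 2)) `^ q.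
pose W j := \sum_(x <- X | layer B g j x) w x.
have pointwise y : y \in Y -> w y * (\sum_(x <- Sph y) g x) `^ q <=
    \sum_(j <- J) \sum_(i < D.+1) if many i j y then K i j * w y else 0.
  move=> yY; have term_ge0 i j : 0 <= if many i j y then K i j * w y else 0.
    by case: ifP => _; rewrite ?mulr_ge0 ?powR_ge0.
  have : 0 <= \sum_(x <- Sph y) g x by exact: sumr_ge0.
  rewrite le_eqVlt => /orP[/eqP <-|Sg0].
    rewrite powR0 ?gt_eqF// mulr0; apply: sumr_ge0 => j _; exact: sumr_ge0.
  have [i [j [ij le_sum]]] := layer_pigeonhole B1 (sizeS y) g0 Sg0.
  have jJ : j \in J.
    have : has (layer B g j) (Sph y).
      by rewrite has_count -(ltr_nat R) (lt_le_trans _ ij)// powR_gt0.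
    move=> /hasP[x /(SX _ yY) xX /andP[_ /eqP <-]].
    by rewrite mem_undup; apply: map_f.
  have le_single := le_sum2 i (undup_uniq _) jJ term_ge0.
  apply: (le_trans _ le_single); rewrite /many ij mulrC ler_wpM2r// /K.
  apply: ge0_ler_powR => //; first exact: ltW.
    by rewrite nnegrE ltW.
  by rewrite nnegrE mulr_ge0 ?powR_ge0.
(* the factor B ^ i disappears: this is why i only costs D + 1 *)
have termE i j : K i j * (M * W j `^ p^-1 / B `^ i%:R) `^ q =
    (D.+2%:R * M * B `^ 2) `^ q * ((B `^ j%:~R) `^ p * W j) `^ (q / p).
  have W0 : 0 <= W j by exact: sumr_ge0.
  rewrite powR_pth_root ?powR_ge0//.
  have K0 : 0 <= D.+2%:R * B `^ (i%:R + j%:~R + 2) by rewrite mulr_ge0 ?powR_ge0.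
  have MW0 : 0 <= M * W j `^ p^-1 / B `^ i%:R.
    by rewrite divr_ge0 ?mulr_ge0 ?powR_ge0.
  have DM0 : 0 <= D.+2%:R * M * B `^ 2 by rewrite !mulr_ge0 ?powR_ge0.
  have BW0 : 0 <= B `^ j%:~R * W j `^ p^-1 by rewrite mulr_ge0 ?powR_ge0.
  rewrite /K -(powRM _ K0 MW0) -(powRM _ DM0 BW0); congr (_ `^ q).
  rewrite !powR_add//; have : B `^ i%:R != 0 by rewrite gt_eqF ?powR_gt0.
  by move=> ?; field.
rewrite big_seq; apply: (le_trans (ler_sum _ pointwise)); rewrite -big_seq.
rewrite exchange_big/=.
apply: (@le_trans _ _ (\sum_(j <- J) D.+1%:R * ((D.+2%:R * M * B `^ 2) `^ q *
    ((B `^ j%:~R) `^ p * W j) `^ (q / p)))).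
  apply: ler_sum => j _; rewrite exchange_big/=.
  rewrite mulr_natl -[X in _ *+ X]card_ord -sumr_const; apply: ler_sum => i _.
  rewrite -big_mkcond -mulr_sumr -(termE i); apply: ler_wpM2l.
    exact: powR_ge0.
  exact: layer_weak_type.
rewrite -mulr_sumr -mulr_sumr mulrA ler_wpM2l ?mulr_ge0 ?powR_ge0//.
have qp1 : 1 <= q / p by rewrite ler_pdivlMr// mul1r.
apply: le_trans (sum_powR_le _ qp1 _) _.
  by move=> j; rewrite mulr_ge0 ?powR_ge0 ?sumr_ge0.
apply: ge0_ler_powR; rewrite ?nnegrE.
- exact: le_trans qp1.
- by apply: sumr_ge0 => j _; rewrite mulr_ge0 ?powR_ge0 ?sumr_ge0.
- by apply: sumr_ge0 => x _; rewrite mulr_ge0 ?powR_ge0.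
- by apply: layer_sum_le; rewrite ?undup_uniq.
Qed.

(** * Distance and spheres in the rooted tree *)

Lemma walk_tree_dist (k : nat) (x y : tree k) : walk_length x y (tree_dist x y).
Proof. by rewrite /tree_dist; case: ex_minnP. Qed.

Lemma tree_dist_le (k : nat) (x y : tree k) (n : nat) :
  walk_length x y n -> (tree_dist x y <= n)%N.
Proof. by rewrite /tree_dist; case: ex_minnP => m _; apply. Qed.

Lemma edge_sym (k : nat) : symmetric (@edge k).
Proof. by move=> x y; rewrite /edge orbC. Qed.

Lemma walk_length_sym (k : nat) (x y : tree k) (n : nat) :
  walk_length x y n -> walk_length y x n.
Proof.
move=> /asboolP[s [ps <- <-]]; apply/asboolP.
exists (rev (belast x s)); split; last by rewrite size_rev size_belast.
- by rewrite rev_path (eq_path (e' := @edge k))// => a b; exact: edge_sym.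
- case: s ps => //= a s _; by rewrite rev_cons last_rcons.
Qed.

Lemma tree_dist_sym (k : nat) (x y : tree k) : tree_dist x y = tree_dist y x.
Proof.
apply/eqP; rewrite eqn_leq.
by rewrite !tree_dist_le//; apply/walk_length_sym/walk_tree_dist.
Qed.

Lemma edge_size (k : nat) (x y : tree k) : edge x y -> (size y <= (size x).+1)%N.
Proof.
move=> /orP[|] /existsP[i /eqP ->] //=; exact: (leq_trans _ (leqnSn _)).
Qed.

Lemma walk_size (k : nat) (x y : tree k) (n : nat) :
  walk_length x y n -> (size y <= size x + n)%N.
Proof.
move=> /asboolP[s [ps <- <-]]; elim: s x ps => [|a s IH] x /=.
  by rewrite addn0.
move=> /andP[/edge_size xa /IH]; move/leq_trans; apply.
by rewrite addnS -addSn leq_add2r.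
Qed.

(** A step raises the depth by at most one, so no walk shorter than the
    descending one reaches a descendant. *)
Lemma tree_dist_descendant (k : nat) (x : tree k) (t : seq 'I_k) :
  tree_dist x ((t ++ x : seq 'I_k) : tree k) = size t.
Proof.
apply/eqP; rewrite eqn_leq; apply/andP; split; last first.
  have := walk_size (walk_tree_dist x ((t ++ x : seq 'I_k) : tree k)).
  by rewrite size_cat addnC leq_add2l.
apply: tree_dist_le; elim: t => [|i t /asboolP[s [ps ls ss]]].
  by apply/asboolP; exists [::].
apply/asboolP; exists (rcons s ((i :: t ++ x : seq 'I_k) : tree k)).
split; last by rewrite size_rcons ss.
- rewrite rcons_path ps ls /edge /child.
  by apply/orP; left; apply/existsP; exists i.
- by rewrite last_rcons.
Qed.

Lemma sphere0 (k : nat) (x : tree k) : sphere x 0 = [set x].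
Proof.
apply/seteqP; split=> y; rewrite /sphere /=.
  move=> d0; have := walk_tree_dist x y; rewrite d0 => /asboolP[s [_ <-]].
  by move/size0nil => ->.
by move=> ->; exact: (tree_dist_descendant x [::]).
Qed.

(** Every vertex has at most k + 1 neighbours. *)
Lemma walk_cover (k : nat) (x : tree k) (n : nat) : exists2 s : seq (tree k),
  (size s <= k.+1 ^ n)%N & forall y, walk_length x y n -> y \in s.
Proof.
pose nbrs (z : tree k) : seq (tree k) :=
  (behead z : tree k) :: [seq (i :: z : tree k) | i <- enum 'I_k].
have edge_nbrs z y : edge z y -> y \in nbrs z.
  move=> /orP[|] /existsP[i /eqP ->]; rewrite inE ?eqxx//; apply/orP; right.
  by apply: map_f; rewrite mem_enum.
elim: n => [|n [s szs covs]].
  exists [:: x] => // y /asboolP[s [_ <-]] /size0nil ->; exact: mem_head.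
exists (flatten [seq nbrs z | z <- s]).
  rewrite size_flatten /shape -map_comp sumnE big_map.
  rewrite (eq_bigr (fun=> k.+1)); last first.
    by move=> z _; rewrite /= size_map size_enum_ord.
  by rewrite big_const_seq count_predT iter_addn_0 mulnC expnSr leq_mul2r szs orbT.
move=> y /asboolP[t [pt lt st]].
case/lastP: t pt lt st => [//|t z]; rewrite rcons_path last_rcons size_rcons.
move=> /andP[pt /edge_nbrs nz] <- [st]; apply/flatten_mapP.
by exists (last x t) => //; apply: covs; apply/asboolP; exists t.
Qed.

Lemma finite_sphere (k : nat) (x : tree k) (r : nat) : finite_set (sphere x r).
Proof.
have [s _ covs] := walk_cover x r.
apply: (@sub_finite_set _ _ [set` s]) => [y dxy|].
  by apply: covs; rewrite -dxy; exact: walk_tree_dist.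
exact: finite_seq.
Qed.

Definition sphere_seq (k : nat) (x : tree k) (r : nat) : seq (tree k) :=
  finmap.enum_fset (fset_set (sphere x r)).

Lemma mem_sphere_seq (k : nat) (x y : tree k) (r : nat) :
  (y \in sphere_seq x r) = (tree_dist x y == r).
Proof.
rewrite in_fset_set; last exact: finite_sphere.
by apply/idP/eqP; rewrite inE.
Qed.

Lemma sphere_seq_uniq (k : nat) (x : tree k) (r : nat) : uniq (sphere_seq x r).
Proof. exact: finmap.fset_uniq. Qed.

Lemma size_sphere_le (k : nat) (x : tree k) (r : nat) :
  (size (sphere_seq x r) <= k.+1 ^ r)%N.
Proof.
have [s szs covs] := walk_cover x r; apply: leq_trans szs.
apply: uniq_leq_size; first exact: sphere_seq_uniq.
move=> y; rewrite mem_sphere_seq => /eqP dxy.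
by apply: covs; rewrite -dxy; exact: walk_tree_dist.
Qed.

(** The descendants of x that are r levels below it already number k ^ r. *)
Lemma size_sphere_ge (k : nat) (x : tree k) (r : nat) :
  (k ^ r <= size (sphere_seq x r))%N.
Proof.
have -> : (k ^ r)%N = size [seq (tval t ++ x : tree k) | t <- enum {: r.-tuple 'I_k}].
  by rewrite size_map -cardE card_tuple card_ord.
apply: uniq_leq_size.
  rewrite map_inj_uniq ?enum_uniq// => t u.
  move/(congr1 (take r)); rewrite !take_size_cat ?size_tuple//.
  exact: val_inj.
move=> y /mapP[t _ ->]; rewrite mem_sphere_seq.
by rewrite (tree_dist_descendant x t) size_tuple.
Qed.

(** * Consequences of the weight condition *)

Lemma esum_seq (R : realType) (T : choiceType) (s : seq T) (a : T -> R) :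
  uniq s -> (forall x, 0 <= a x) ->
  (\esum_(x in [set` s]) (a x)%:E = (\sum_(x <- s) a x)%:E)%E.
Proof.
move=> us a0; rewrite esum_fset//; first by rewrite -fsbig_seq// sumEFin.
by move=> x _; rewrite lee_fin.
Qed.

(** The restricted weak type (p, q) inequality, with constant M, for the
    operator summing a function over the spheres of radius r. *)
Definition weak_type_at (R : realType) (k : nat) (w : tree k -> R) (p q M : R) (r : nat) :=
  forall E F : seq (tree k), uniq E -> uniq F ->
    \sum_(x <- E) \sum_(y <- F | y \in sphere_seq x r) w y <=
    M * (\sum_(x <- E) w x) `^ p^-1 * (\sum_(y <- F) w y) `^ (1 - q^-1).

Lemma Z_class_weak_type (R : realType) (k : nat) (w : tree k -> R) (p q eps alpha : R) :
  Z_class p q eps alpha w ->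
  (forall x, 0 <= w x) /\
  exists2 C : R, 0 < C & forall r, (0 < r)%N ->
    weak_type_at w p q (C * k%:R `^ (eps * r%:R * (1 - alpha))) r.
Proof.
move=> [w0 [C C0 hC]]; split=> //; exists C => // r r0 E F uE uF.
have := hC r [set` E] [set` F] r0; rewrite /wmass.
rewrite !esum_seq//.
under eq_esum => x _.
  have -> : [set` F] `&` sphere x r = [set` [seq y <- F | y \in sphere_seq x r]].
    apply/seteqP; split=> y /=; rewrite mem_filter mem_sphere_seq /sphere /=.
      by move=> [-> ->]; rewrite eqxx.
    by move=> /andP[/eqP ->].
  rewrite esum_seq ?filter_uniq// big_filter.
  over.
by rewrite esum_seq// => x; exact: sumr_ge0.
Qed.

(** For neighbours x and y the inequality for singletons gives
    w y <= M^q (w x)^s with s = q / p. Going back from x to y gives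
    w y <= L (w y)^(s^2); multiplying by (w y)^s and taking (s + 1)-th roots
    yields the exponent s. This also covers p = q, where no lower bound on w
    is available. *)
Lemma weight_power_bound (R : realType) (k : nat) (w : tree k -> R) (p q M : R) :
  (0 < k)%N -> 0 < p -> 0 < q -> 0 < M -> (forall x, 0 <= w x) ->
  weak_type_at w p q M 1 ->
  exists2 K : R, 0 < K & forall y, w y <= K * w y `^ (q / p).
Proof.
move=> k0 p0 q0 M0 w0 weak; set s := q / p.
have s0 : 0 < s by rewrite divr_gt0.
have neighbour x y : tree_dist x y = 1%N -> w y <= M `^ q * w x `^ s.
  move=> dxy; have := weak [:: x] [:: y] isT isT.
  rewrite !big_seq1 big_mkcond big_seq1 mem_sphere_seq dxy eqxx => h.
  have := @weak_type_solve R (w y) 1 (M * w x `^ p^-1) q.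
  rewrite mul1r divr1 => /(_ (w0 y) ltr01 _ q0 h).
  rewrite powRM ?powR_ge0 ?(ltW M0)// -powRrM mulrC /s [q / p]mulrC.
  by rewrite mulrC; apply; rewrite mulr_ge0 ?powR_ge0 ?ltW.
clearbody s.
pose L := M `^ q * (M `^ q) `^ s.
have L0 : 0 < L by rewrite mulr_gt0 ?powR_gt0.
have rootK a : 0 <= a -> (a `^ (s + 1)) `^ (s + 1)^-1 = a.
  by move=> a0; rewrite -powRrM mulfV ?powRr1// gt_eqF// addr_gt0.
exists (L `^ (s + 1)^-1); first exact: powR_gt0.
move=> y; pose x : tree k := Ordinal k0 :: y.
have dyx : tree_dist y x = 1%N by exact: (tree_dist_descendant y [:: Ordinal k0]).
have wyy : w y <= L * (w y `^ s) `^ s.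
  have dxy : tree_dist x y = 1%N by rewrite tree_dist_sym.
  have wxs : w x `^ s <= (M `^ q * w y `^ s) `^ s.
    apply: ge0_ler_powR; last exact: neighbour.
    - exact: ltW.
    - by rewrite nnegrE.
    - by rewrite nnegrE mulr_ge0 ?powR_ge0.
  rewrite (powRM _ (powR_ge0 _ _) (powR_ge0 _ _)) in wxs.
  by rewrite /L -mulrA (le_trans (neighbour _ _ dxy))// ler_wpM2l ?powR_ge0.
have s1 : 0 < s + 1 by rewrite addr_gt0.
clearbody L.
have -> : L `^ (s + 1)^-1 * w y `^ s = (L * (w y `^ s) `^ (s + 1)) `^ (s + 1)^-1.
  by rewrite (powRM _ (ltW L0) (powR_ge0 _ _)) rootK ?powR_ge0.
rewrite -[leLHS](rootK _ (w0 y)).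
apply: ge0_ler_powR.
- by rewrite invr_ge0 ltW.
- exact: powR_ge0.
- by rewrite nnegrE mulr_ge0 ?powR_ge0 ?(ltW L0).
have split1 a : 0 <= a -> a `^ (s + 1) = a * a `^ s.
  by move=> a0; rewrite -(mulr_powRB1 a0 s1) addrK.
by rewrite !split1 ?powR_ge0// [leLHS]mulrC mulrCA ler_wpM2l ?powR_ge0.
Qed.

(** * Decay of the spherical averages *)

(** Normalizing by a power of k ^ r instead of the cardinality of the sphere
    can only enlarge the average, and makes its dependence on r explicit. *)
Definition sphere_avg (R : realType) (k : nat) (alpha : R) (g : tree k -> R) (r : nat)
    (y : tree k) : R :=
  k%:R `^ (- (r%:R * (1 - alpha))) * \sum_(x <- sphere_seq y r) g x.

(** [restricted_weak_to_strong] with B = k ^ (2 r / D): the crude estimate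
    |S(x,r)| <= (k + 1) ^ r <= k ^ (2 r) = B ^ D suffices, because the loss
    B ^ 2 = k ^ (4 r / D) can be made as small a power of k ^ r as desired. *)
Lemma sphere_avg_strong (R : realType) (k D : nat) (w : tree k -> R)
    (p q alpha M N : R) (r : nat) (g : tree k -> R) :
  (2 <= k)%N -> (0 < D)%N -> (0 < r)%N -> 0 < p -> p <= q -> 0 <= M ->
  (forall x, 0 <= w x) -> weak_type_at w p q M r -> (forall x, 0 <= g x) ->
  (forall X : seq (tree k), uniq X -> \sum_(x <- X) w x * g x `^ p <= N) ->
  forall Y : seq (tree k), uniq Y ->
  \sum_(y <- Y) w y * sphere_avg alpha g r y `^ q <=
  D.+1%:R * (D.+2%:R * M * k%:R `^ (r%:R * (4 / D%:R - (1 - alpha)))) `^ q *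
    N `^ (q / p).
Proof.
move=> k2 D0 r0 p0 pq M0 w0 weak g0 normN Y uY.
have q0 : 0 < q by exact: lt_le_trans pq.
have k0 : 0 < k%:R :> R by rewrite ltr0n; lia.
have DR : 0 < D%:R :> R by rewrite ltr0n.
pose B : R := k%:R `^ (2 * r%:R / D%:R).
have B1 : 1 < B.
  rewrite -[ltLHS](powRr0 k%:R) ltr_powRr ?ltr1n//.
  by rewrite divr_gt0// mulr_gt0// ltr0n.
have sizeB (y : tree k) : (size (sphere_seq y r))%:R <= B `^ D%:R.
  rewrite -powRrM divfK ?(gt_eqF DR)// -natrM powR_mulrn ?(ltW k0)//.
  rewrite -natrX ler_nat (leq_trans (size_sphere_le y r))// expnM.
  by rewrite leq_exp2r// -mulnn; nia.
set X := undup (flatten [seq sphere_seq y r | y <- Y]).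
have SX y : y \in Y -> {subset sphere_seq y r <= X}.
  by move=> yY x xy; rewrite mem_undup; apply/flatten_mapP; exists y.
have symS (x y : tree k) : (x \in sphere_seq y r) = (y \in sphere_seq x r).
  by rewrite !mem_sphere_seq tree_dist_sym.
have uS (y : tree k) : uniq (sphere_seq y r) by exact: sphere_seq_uniq.
have strong := restricted_weak_to_strong p0 pq M0 B1 w0 uS symS sizeB weak g0
  (undup_uniq _) uY SX.
set c : R := k%:R `^ (- (r%:R * (1 - alpha))).
have c0 : 0 <= c by exact: powR_ge0.
have -> : \sum_(y <- Y) w y * sphere_avg alpha g r y `^ q =
    c `^ q * \sum_(y <- Y) w y * (\sum_(x <- sphere_seq y r) g x) `^ q.
  rewrite mulr_sumr; apply: eq_bigr => y _.
  by rewrite /sphere_avg powRM ?sumr_ge0// mulrCA.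
apply: (le_trans (ler_wpM2l (powR_ge0 c q) strong)).
have -> : k%:R `^ (r%:R * (4 / D%:R - (1 - alpha))) = c * B `^ 2.
  by rewrite /B /c -powRrM -powR_add//; congr (_ `^ _); ring.
have -> : D.+2%:R * M * (c * B `^ 2) = c * (D.+2%:R * M * B `^ 2) by ring.
have DMB0 : 0 <= D.+2%:R * M * B `^ 2 by rewrite !mulr_ge0 ?powR_ge0.
rewrite [(c * _) `^ q](powRM _ c0 DMB0) [X in _ <= X * _]mulrCA -[leRHS]mulrA.
apply: ler_wpM2l; first exact: powR_ge0.
apply: ler_wpM2l; first by rewrite mulr_ge0 ?powR_ge0.
have sum0 : 0 <= \sum_(x <- X) w x * g x `^ p.
  by apply: sumr_ge0 => x _; rewrite mulr_ge0 ?powR_ge0.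
have sumN : \sum_(x <- X) w x * g x `^ p <= N by exact/normN/undup_uniq.
apply: ge0_ler_powR => //; first by rewrite divr_ge0 ?ltW.
by rewrite nnegrE (le_trans sum0).
Qed.

(** With eta = (1 - eps)(1 - alpha), taking D > 8 / eta makes the loss
    k ^ (4 r / D) at most k ^ (r eta / 2) and leaves the ratio
    rho = k ^ (- q eta / 2). *)
Lemma sphere_avg_decay (R : realType) (k : nat) (w : tree k -> R) (p q alpha eps : R) :
  (2 <= k)%N -> 0 < p -> p <= q -> alpha < 1 -> eps < 1 ->
  Z_class p q eps alpha w ->
  exists c rho : R, [/\ 0 < c, 0 <= rho < 1 &
    forall (g : tree k -> R) (N : R) (r : nat) (Y : seq (tree k)),
    (forall x, 0 <= g x) ->
    (forall X : seq (tree k), uniq X -> \sum_(x <- X) w x * g x `^ p <= N) ->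
    uniq Y ->
    \sum_(y <- Y) w y * sphere_avg alpha g r y `^ q <= c * rho ^+ r * N `^ (q / p)].
Proof.
move=> k2 p0 pq alpha1 eps1 Zw.
have [w0 [C C0 weak]] := Z_class_weak_type Zw.
have q0 : 0 < q by exact: lt_le_trans pq.
have k0 : 0 < k%:R :> R by rewrite ltr0n; lia.
have k1 : 1 < k%:R :> R by rewrite ltr1n.
pose eta := (1 - eps) * (1 - alpha).
have eta0 : 0 < eta by rewrite mulr_gt0// subr_gt0.
pose D := (Num.truncn (8 / eta)).+1.
have D0 : 0 < D%:R :> R by rewrite ltr0n.
have D4 : 4 / D%:R <= eta / 2.
  have : 8 / eta < D%:R by exact: truncnS_gt.
  rewrite ltr_pdivrMr// => h; rewrite ler_pdivrMr//; lra.
pose rho : R := k%:R `^ (- (eta / 2 * q)).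
have rho1 : rho < 1.
  rewrite -[ltRHS](powRr0 k%:R) ltr_powRr// oppr_lt0.
  by rewrite mulr_gt0// divr_gt0.
have k_gt0 : (0 < k)%N by exact: ltnW.
have M10 : 0 < C * k%:R `^ (eps * 1%:R * (1 - alpha)).
  by rewrite mulr_gt0 ?powR_gt0.
have [K K0 wK] := weight_power_bound k_gt0 p0 q0 M10 w0 (weak 1%N isT).
pose c1 : R := D.+1%:R * (D.+2%:R * C) `^ q.
have c10 : 0 < c1 by rewrite mulr_gt0 ?powR_gt0 ?mulr_gt0.
exists (K + c1), rho; split; [exact: addr_gt0|by rewrite powR_ge0|].
move=> g N r Y g0 normN uY.
have wg0 x : 0 <= w x * g x `^ p by rewrite mulr_ge0 ?powR_ge0.
have N0 : 0 <= N by have := normN [::] isT; rewrite big_nil.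
have Nqp0 : 0 <= N `^ (q / p) by exact: powR_ge0.
have qp1 : 1 <= q / p by rewrite ler_pdivlMr// mul1r.
have [->|r_gt0] := posnP r.
  have -> : \sum_(y <- Y) w y * sphere_avg alpha g 0 y `^ q =
      \sum_(y <- Y) w y * g y `^ q.
    apply: eq_bigr => y _; rewrite /sphere_avg mul0r oppr0 powRr0 mul1r.
    rewrite (perm_big [:: y]) ?big_seq1//; apply: uniq_perm => //.
      exact: sphere_seq_uniq.
    move=> x; rewrite mem_sphere_seq inE; apply/eqP/eqP.
      by have := sphere0 y; rewrite /sphere => /seteqP[+ _] => /(_ x) /=.
    by move=> ->; have := sphere0 y; rewrite /sphere => /seteqP[_ /(_ y)]; exact.
  rewrite expr0 mulr1; apply: (@le_trans _ _ (K * N `^ (q / p))); last first.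
    by rewrite ler_wpM2r// lerDl ltW.
  apply: (@le_trans _ _ (K * \sum_(y <- Y) (w y * g y `^ p) `^ (q / p))).
    rewrite mulr_sumr; apply: ler_sum => y _.
    rewrite powRM ?powR_ge0// -powRrM [p * _]mulrC divfK ?(gt_eqF p0)//.
    by rewrite mulrA ler_wpM2r ?powR_ge0.
  rewrite ler_wpM2l ?(ltW K0)//.
  apply: (le_trans (sum_powR_le _ qp1 wg0)).
  apply: ge0_ler_powR; rewrite ?nnegrE ?sumr_ge0//; last exact: normN.
  exact: le_trans qp1.
have M0 : 0 <= C * k%:R `^ (eps * r%:R * (1 - alpha)).
  by rewrite mulr_ge0 ?powR_ge0 ?(ltW C0).
have := sphere_avg_strong (D := D) alpha k2 isT r_gt0 p0 pq M0 w0
  (weak r r_gt0) g0 normN uY.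
move=> /le_trans; apply; rewrite ler_wpM2r//.
apply: (@le_trans _ _ (c1 * rho ^+ r)); last first.
  by rewrite ler_wpM2r ?exprn_ge0 ?powR_ge0// lerDr ltW.
rewrite /c1 -[leRHS]mulrA; apply: ler_wpM2l; first by [].
set a := eps * _ * _; set b := r%:R * _.
have -> : D.+2%:R * (C * k%:R `^ a) * k%:R `^ b = D.+2%:R * C * k%:R `^ (a + b).
  by rewrite powR_add//; ring.
have DC0 : 0 <= D.+2%:R * C by rewrite mulr_ge0 ?(ltW C0).
rewrite (powRM _ DC0 (powR_ge0 _ _)); apply: ler_wpM2l; first exact: powR_ge0.
rewrite -powRrM /rho -(powR_mulrn _ (powR_ge0 _ _)) -powRrM /a /b.
apply: ler_powR; first exact: ltW.
have rR : 0 < r%:R :> R by rewrite ltr0n.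
have -> : (eps * r%:R * (1 - alpha) + r%:R * (4 / D%:R - (1 - alpha))) * q =
  r%:R * q * (4 / D%:R - eta) by rewrite /eta; ring.
have -> : - (eta / 2 * q) * r%:R = r%:R * q * (- (eta / 2)) by ring.
rewrite ler_wpM2l ?mulr_ge0 ?(ltW rR) ?(ltW q0)//; lra.
Qed.

(** * The maximal operator *)

(** The cardinality of the sphere is at least k ^ r. *)
Lemma normalized_sphere_sum_le (R : realType) (k : nat) (alpha : R) (f : tree k -> R) r y :
  (0 < k)%N -> alpha < 1 ->
  ((counting (sphere y r) `^ (1 - alpha))^-1 *
     (\esum_(x in sphere y r) (`|f x|%R)%:E) <=
   (sphere_avg alpha (fun x => `|f x|%R) r y)%:E)%E.
Proof.
move=> k0 alpha1.
have sphereE : sphere y r = [set` sphere_seq y r].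
  by apply/seteqP; split=> x /=; rewrite mem_sphere_seq /sphere /= => /eqP.
have countE : counting (sphere y r) = (size (sphere_seq y r))%:R%:E :> \bar R.
  by rewrite /counting asboolT//; exact: finite_sphere.
have kr0 : 0 < (k ^ r)%:R :> R by rewrite ltr0n expn_gt0 k0.
have n0 : 0 < (size (sphere_seq y r))%:R :> R.
  by rewrite (lt_le_trans kr0)// ler_nat size_sphere_ge.
rewrite countE [in X in (_ * X)%E]sphereE esum_seq ?sphere_seq_uniq//.
rewrite poweR_EFin inver gt_eqF ?powR_gt0// -EFinM lee_fin.
apply: ler_wpM2r; first exact: sumr_ge0.
have kR0 : 0 < k%:R :> R by rewrite ltr0n.
rewrite powRN lef_pV2 ?posrE ?powR_gt0//.
rewrite powRrM powR_mulrn// -natrX.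
apply: ge0_ler_powR; rewrite ?nnegrE ?subr_ge0 ?(ltW alpha1) ?(ltW kr0) ?(ltW n0)//.
by rewrite ler_nat size_sphere_ge.
Qed.

(** The supremum over r of nonnegative numbers is at most their l^q norm. *)
Lemma spherical_max_powR_le (R : realType) (k : nat) (alpha q : R) (f : tree k -> R) y :
  (0 < k)%N -> alpha < 1 -> 0 < q ->
  (`|spherical_fractional_max alpha f y| `^ q <=
   \sum_(0 <= r <oo) (sphere_avg alpha (fun x => `|f x|%R) r y `^ q)%:E)%E.
Proof.
move=> k0 alpha1 q0; pose A r := sphere_avg alpha (fun x => `|f x|) r y.
have A0 r : 0 <= A r by rewrite mulr_ge0 ?powR_ge0// sumr_ge0.
set X := (\sum_(0 <= r <oo) _)%E.
have X0 : (0 <= X)%E by apply: nneseries_ge0 => r _ _; rewrite lee_fin powR_ge0.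
have AX r : ((A r `^ q)%:E <= X)%E.
  apply: le_trans (nneseries_lim_ge r.+1 _); last first.
    by move=> i _ _; rewrite lee_fin powR_ge0.
  rewrite big_nat_recr//= leeDr// sume_ge0// => i _; by rewrite lee_fin powR_ge0.
have S0 : (0 <= spherical_fractional_max alpha f y)%E.
  apply: le_ereal_sup_tmp; eexists; first by exists 0%N.
  apply: mule_ge0; first by rewrite inve_ge0 poweR_ge0.
  by apply: esum_ge0 => x _; rewrite lee_fin.
have SX : (spherical_fractional_max alpha f y <= X `^ q^-1)%E.
  apply: ge_ereal_sup => _ [r _ <-].
  apply: (le_trans (normalized_sphere_sum_le f r y k0 alpha1)); rewrite -/(A r).
  have -> : (A r)%:E = ((A r `^ q)%:E `^ q^-1)%E.
    by rewrite poweR_EFin -powRrM mulfV ?gt_eqF// powRr1.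
  apply: gt0_ler_poweR; rewrite ?invr_ge0 ?(ltW q0)// ?in_itv/= ?leey ?andbT//.
  by rewrite lee_fin powR_ge0.
have -> : X = ((X `^ q^-1) `^ q)%E by rewrite -poweRrM mulVf ?gt_eqF// poweRe1.
rewrite gee0_abs//; apply: gt0_ler_poweR SX; rewrite ?(ltW q0)//.
  by rewrite in_itv/= leey andbT.
by rewrite in_itv/= leey andbT poweR_ge0.
Qed.

Lemma nneseries_le (R : realType) (u : nat -> \bar R) (X : \bar R) :
  (forall n, 0 <= u n)%E -> (forall n, \sum_(0 <= i < n) u i <= X)%E ->
  (\sum_(0 <= i <oo) u i <= X)%E.
Proof.
move=> u0 uX; apply: lime_le; first exact: is_cvg_nneseries.
exact: nearW.
Qed.

Lemma geometric_sum_le (R : realType) (rho : R) (n : nat) :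
  0 <= rho < 1 -> \sum_(0 <= r < n) rho ^+ r <= (1 - rho)^-1.
Proof.
move=> /andP[rho0 rho1]; have d0 : 0 < 1 - rho by rewrite subr_gt0.
rewrite -[leRHS]mul1r ler_pdivlMr// mulrC big_mkord.
rewrite -opprB mulNr -subrX1 opprB gerBl; exact: exprn_ge0.
Qed.

Unset Implicit Arguments.

Theorem theorem1p3 (R : realType) (k : nat) (p q alpha eps : R)
    (w : tree k -> R) (hk : (2 <= k)%N) (hp : 1 < p) (hpq : p <= q)
    (halpha0 : 0 < alpha) (halpha1 : alpha < 1)
    (heps0 : 0 < eps) (heps1 : eps < 1)
    (hw : Z_class p q eps alpha w) :
  exists2 C' : R, 0 < C' &
    forall f : tree k -> R,
      (Lp_norm w q (spherical_fractional_max alpha f) <=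
       C'%:E * Lp_norm w p (fun x => (f x)%:E))%E.
Proof.
have p0 : 0 < p by exact: lt_trans hp.
have q0 : 0 < q by exact: lt_le_trans hpq.
have k0 : (0 < k)%N by exact: ltnW.
have w0 := hw.1.
have [c [rho [c0 /andP[rho0 rho1] decay]]] :=
  sphere_avg_decay hk p0 hpq halpha1 heps1 hw.
pose C := c * (1 - rho)^-1.
have C0 : 0 < C by rewrite mulr_gt0// invr_gt0 subr_gt0.
exists (C `^ q^-1); first exact: powR_gt0.
move=> f; rewrite /Lp_norm; set N := (\esum_(x in _) (`|(f x)%:E| `^ p * _))%E.
have NE : N = (\esum_(x in [set: tree k]) (w x * `|f x| `^ p)%:E)%E.
  by apply: eq_esum => x _; rewrite abse_EFin poweR_EFin -EFinM mulrC.
have N0 : (0 <= N)%E.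
  by rewrite NE; apply: esum_ge0 => x _; rewrite lee_fin mulr_ge0 ?powR_ge0.
have sumN (X : seq (tree k)) : uniq X ->
    ((\sum_(x <- X) w x * `|f x| `^ p)%:E <= N)%E.
  move=> uX; rewrite NE.
  apply: ereal_sup_ubound; exists [set` X]; first by split=> //; exact: finite_seq.
  by rewrite -fsbig_seq// sumEFin.
have Lp_root_y : N = +oo%E -> ((C `^ q^-1)%:E * N `^ p^-1 = +oo)%E.
  move=> ->; rewrite poweRyr ?invr_eq0 ?gt_eqF// mulry gtr0_sg ?powR_gt0//.
  by rewrite mul1e.
have [/Lp_root_y ->|Nfin] := eqVneq N +oo%E; first exact: leey.
have {}Nfin : N \is a fin_num by rewrite ge0_fin_numE// ltey.
rewrite -(fineK Nfin) in sumN N0 *; move: (fine N) => n in sumN N0 *.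
rewrite poweR_EFin -EFinM.
have -> : C `^ q^-1 * n `^ p^-1 = (C * n `^ (q / p)) `^ q^-1.
  rewrite (powRM _ (ltW C0) (powR_ge0 _ _)) -powRrM mulrAC mulfV ?gt_eqF//.
  by rewrite mul1r.
rewrite -poweR_EFin; apply: gt0_ler_poweR.
- by rewrite invr_ge0 ltW.
- rewrite in_itv/= leey andbT; apply: esum_ge0 => y _.
  by rewrite mule_ge0 ?poweR_ge0// lee_fin.
- by rewrite in_itv/= leey andbT lee_fin mulr_ge0 ?powR_ge0 ?(ltW C0).
apply: ge_ereal_sup => _ [F [finF _] <-]; rewrite fsbig_finite//=.
set Y := finmap.enum_fset _; pose A r y := sphere_avg alpha (fun x => `|f x|) r y.
have pointwise y : (`|spherical_fractional_max alpha f y| `^ q * (w y)%:E <=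
    \sum_(0 <= r <oo) (w y * A r y `^ q)%:E)%E.
  rewrite muleC; apply: le_trans (lee_wpmul2l _ (spherical_max_powR_le f y k0 halpha1 q0)) _.
    by rewrite lee_fin.
  rewrite -nneseriesZl; last by move=> r _; rewrite lee_fin powR_ge0.
  by [].
apply: (le_trans (lee_sum _ (fun y _ => pointwise y))).
rewrite -nneseries_sum; last first.
  by move=> y r _; rewrite lee_fin mulr_ge0 ?powR_ge0.
apply: nneseries_le => [r|m].
  by apply: sume_ge0 => y _; rewrite lee_fin mulr_ge0 ?powR_ge0.
under eq_bigr do rewrite sumEFin.
rewrite sumEFin lee_fin.
apply: (@le_trans _ _ (\sum_(0 <= r < m) c * n `^ (q / p) * rho ^+ r)).
  apply: ler_sum => r _; rewrite mulrAC; apply: decay => //.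
    exact: finmap.fset_uniq.
rewrite -mulr_sumr /C [leRHS]mulrAC; apply: ler_wpM2l.
  by rewrite mulr_ge0 ?powR_ge0 ?(ltW c0).
by apply: geometric_sum_le; rewrite rho0.
Qed.
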